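(* Let $G=(X,b)$ be a connected graph. If the space $\mathfrak{D}(G)$ of functions of finite Dirichlet energy is an algebra (with respect to pointwise addition and multiplication of functions), then $G$ is canonically compactifiable.
   Context: A graph $G=(X,b)$ consists of a nonempty countable set $X$ (nodes) and a symmetric function $b:X\times X\to[0,\infty)$ with $b(x,x)=0$ for all $x$ and $\sum_{y\in X}b(x,y)<\infty$ for all $x\in X$. (Local finiteness is not assumed.) Two nodes $x,y$ are connected if there is a finite sequence $x=x_0,\ldots,x_n=y$ with $b(x_k,x_{k+1})>0$ for all $0\le k<n$; the graph is connected if all its nodes are connected to each other. The Dirichlet energy of $f:X\to\mathbb{C}$ is $\tilde{Q}(f)=\frac12\sum_{x,y\in X}b(x,y)|f(x)-f(y)|^2\in[0,\infty]$, and $\mathfrak{D}(G)=\{f:X\to\mathbb{C}\mid \tilde{Q}(f)<\infty\}$, which is a vector space. That $\mathfrak{D}(G)$ is an algebra means that it is closed under pointwise multiplication: $fg\in\mathfrak{D}(G)$ for all $f,g\in\mathfrak{D}(G)$. The graph is canonically compactifiable if $\mathfrak{D}(G)\subseteq\ell^\infty(X)$, i.e. every function of finite energy is bounded. *)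

(* Defs.v *)
From mathcomp Require Import all_boot all_order all_algebra.
From mathcomp Require Import all_classical all_reals all_analysis.
From mathcomp.real_closed Require Import complex.

Set Implicit Arguments.
Unset Strict Implicit.
Unset Printing Implicit Defensive.

Import Order.TTheory GRing.Theory Num.Theory.

Local Open Scope classical_set_scope.
Local Open Scope ring_scope.
Local Open Scope complex_scope.

(* A [countType] is a finite or countably infinite type. [esum] is the
   unordered sum: the supremum of the finite partial sums, in [\bar R]. *)
Record graph (R : realType) := Graph {
  node :> countType;
  node_nonempty : inhabited node;
  weight : node -> node -> R;
  weight_ge0 : forall x y, 0 <= weight x y;
  weight_sym : forall x y, weight x y = weight y x;
  weight_diag : forall x, weight x x = 0;
  weight_summable :
    forall x, (\esum_(y in [set: node]) (weight x y)%:E < +oo)%E }.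

Arguments weight {R} g x y.

Section Graph.
Context {R : realType}.
Implicit Type G : graph R.

Definition neighbors G : rel G := fun x y => 0 < weight G x y.

Definition connected_nodes G (x y : G) : Prop :=
  exists2 p : seq G, path (@neighbors G) x p & last x p = y.

Definition connected_graph G : Prop := forall x y : G, connected_nodes x y.

(* [Normc.normc] is the modulus on [R[i]] with values in [R], whereas the generic
   norm on [R[i]] takes its values in [R[i]]. *)
Definition energy G (f : G -> R[i]) : \bar R :=
  ((2^-1)%:E * \esum_(p in [set: G * G])
     (weight G p.1 p.2 * Normc.normc (f p.1 - f p.2) ^+ 2)%:E)%E.

Definition finite_energy G : set (G -> R[i]) :=
  [set f | (energy f < +oo)%E].

Definition finite_energy_is_algebra G : Prop :=
  forall f g : G -> R[i], finite_energy f -> finite_energy g ->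
    finite_energy (fun x => f x * g x).

Definition ell_infty (X : Type) : set (X -> R[i]) :=
  [set f | exists M : R, forall x, Normc.normc (f x) <= M].

Definition canonically_compactifiable G : Prop :=
  @finite_energy G `<=` @ell_infty G.

End Graph.

(* Main.v *)
(* Suppose [f] is an unbounded function of finite energy and put [F = |f|]. For
   levels [a_k >= 4^k], the function [max (F - a_k) 0] has finite energy, and
   positive energy because the graph is connected; let [u_k] be its positive
   multiple of energy [4^-k]. By Cauchy-Schwarz the pointwise finite sum
   [g = \sum_k u_k] has finite energy. Along an edge on which [u_k] varies, [F]
   exceeds [a_k] at the upper end, and every [u_j] is monotone in [F], so [F * g]
   varies at least as much as [a_k * u_k]. Hence the energy of [F * g] is at
   least [a_k^2 * 4^-k >= 4^k] for all [k], and [F * g] has infinite energy. *)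

Require Import Defs.
From mathcomp Require Import all_boot all_order all_algebra.
From mathcomp Require Import all_classical all_reals all_analysis.
From mathcomp Require Import finmap ring lra.
From mathcomp.real_closed Require Import complex.

Set Implicit Arguments.
Unset Strict Implicit.
Unset Printing Implicit Defensive.

Import Order.TTheory GRing.Theory Num.Theory.

Local Open Scope classical_set_scope.
Local Open Scope ring_scope.
Local Open Scope complex_scope.

Section RealFacts.
Context {R : realType}.

Lemma ler_dist_normc (x y : R[i]) :
  `|Normc.normc x - Normc.normc y| <= Normc.normc (x - y).
Proof.
rewrite -lecR.
have -> : (`|Normc.normc x - Normc.normc y|)%:C = `| `|x| - `|y| | :> R[i].
  rewrite -[ `|x|]/(Normc.normc x)%:C -[ `|y|]/(Normc.normc y)%:C -rmorphB.
  by rewrite normc_def /= expr0n addr0 sqrtr_sqr.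
exact: (@ler_dist_dist _ R[i]).
Qed.

Lemma ler_dist_max0 (s t : R) : `|Num.max s 0 - Num.max t 0| <= `|s - t|.
Proof.
rewrite ler_norml lerNl !ler_normr.
by apply/andP; split; apply/orP; have [s0|s0] := leP s 0; have [t0|t0] := leP t 0;
  have [st|st] := leP s t;
  first [left; lra | right; lra].
Qed.

Lemma normcR (r : R) : Normc.normc r%:C = `|r|.
Proof. by rewrite /= expr0n addr0 sqrtr_sqr. Qed.

(** Cauchy-Schwarz with weights independent of [n]. Peeling off the first term and using
    [(a + b)^2 <= 2 a^2 + 2 b^2] doubles every later weight. *)
Lemma sqr_sum_le n (u : nat -> R) :
  (\sum_(k < n) u k) ^+ 2 <= \sum_(k < n) 2 ^+ k.+1 * u k ^+ 2.
Proof.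
elim: n u => [|n IHn] u; first by rewrite !big_ord0 expr0n.
rewrite !big_ord_recl /=.
have := IHn (fun k => u k.+1); rewrite /bump /=.
under [in X in _ -> X]eq_bigr do rewrite add1n.
under [X in _ -> _ <= _ + X]eq_bigr do rewrite add1n exprS -mulrA.
rewrite -mulr_sumr.
set s := \sum_(_ < _) u _; set t := \sum_(_ < _) _ => st.
by have := sqr_ge0 (u 0 - s); rewrite expr1; nra.
Qed.

Lemma sum_geometric_le4 n : \sum_(k < n) (2 ^+ k.+1 * (4 ^+ k)^-1) <= 4 :> R.
Proof.
suff -> : \sum_(k < n) (2 ^+ k.+1 * (4 ^+ k)^-1) = 4 - 4 * (2 ^+ n)^-1 :> R.
  by rewrite lerBlDr lerDl mulr_ge0 ?invr_ge0 ?exprn_ge0.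
elim: n => [|n IHn]; first by rewrite big_ord0 expr0 invr1 mulr1 subrr.
have n0 : 2 ^+ n != 0 :> R by rewrite expf_neq0 // pnatr_eq0.
rewrite big_ord_recr /= IHn; have -> : 4 = 2 * 2 :> R by ring.
by rewrite exprMn !exprS; field.
Qed.

End RealFacts.

Section Dirichlet.
Context {R : realType} {G : graph R}.
Implicit Types u v : G -> R.

Definition edge_energy u (p : G * G) : R :=
  weight G p.1 p.2 * (u p.1 - u p.2) ^+ 2.

(** Twice the energy of the real function [u]; the factor does not affect finiteness. *)
Definition dirichlet u : \bar R :=
  \esum_(p in [set: G * G]) (edge_energy u p)%:E.

Lemma edge_energy_ge0 u p : 0 <= edge_energy u p.
Proof. by rewrite mulr_ge0 ?weight_ge0 ?sqr_ge0. Qed.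

Lemma dirichlet_ge0 u : (0 <= dirichlet u)%E.
Proof. by apply: esum_ge0 => p _; rewrite lee_fin edge_energy_ge0. Qed.

Lemma le_dirichlet u v :
  (forall x y, `|u x - u y| <= `|v x - v y|) -> (dirichlet u <= dirichlet v)%E.
Proof.
move=> uv; apply: le_esum => -[x y] _; rewrite lee_fin ler_wpM2l ?weight_ge0 //=.
by rewrite -real_normK ?num_real // -[leRHS]real_normK ?num_real // lerXn2r ?nnegrE.
Qed.

Lemma dirichletZ c u :
  dirichlet (fun x => c * u x) = ((c ^+ 2)%:E * dirichlet u)%E.
Proof.
rewrite /dirichlet /esum -ereal_supZl ?sqr_ge0 //; last first.
  by apply/set0P; eexists; exists set0; [exact: fsets_set0|reflexivity].
rewrite image_comp; congr ereal_sup; apply: eq_imagel => X _ /=.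
rewrite ge0_mule_fsumr => [|p]; last by rewrite lee_fin edge_energy_ge0.
apply: eq_fsbigr => p _; rewrite -EFinM; congr EFin; rewrite /edge_energy; ring.
Qed.

(** Each edge term is a one-pair partial sum, hence vanishes, so [u] keeps its value along every
    path. *)
Lemma dirichlet_eq0_const u : connected_graph G -> dirichlet u = 0%E ->
  forall x y, u x = u y.
Proof.
move=> Gc u0 x y; have [p + <-] := Gc x y.
elim: p x => //= z p IHp x /andP[xz /IHp <-].
have : (edge_energy u (x, z))%:E = 0%E.
  apply/le_anti/andP; split; last by rewrite lee_fin edge_energy_ge0.
  rewrite -[leRHS]u0.
  by apply: esum_ge; exists [set (x, z)]; rewrite ?fsbig_set1.
move=> [/eqP]; rewrite mulf_eq0 gt_eqF //= expf_eq0 /= subr_eq0.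
by move/eqP.
Qed.

Lemma edge_energy_sum_le n (u : nat -> G -> R) p :
  edge_energy (fun x => \sum_(k < n) u k x) p
    <= \sum_(k < n) 2 ^+ k.+1 * edge_energy (u k) p.
Proof.
under eq_bigr do rewrite mulrCA.
rewrite -mulr_sumr ler_wpM2l ?weight_ge0 //= -sumrB.
exact: (sqr_sum_le n (fun k => u k p.1 - u k p.2)).
Qed.

(** A finite set of pairs meets only finitely many nodes, so on it [g] is one finite sum. The
    weighted Cauchy-Schwarz bound is then at most 4, whatever the set. *)
Lemma dirichlet_sum_lty (u : nat -> G -> R) (N : G -> nat) (g : G -> R) :
    (forall x n, (N x <= n)%N -> g x = \sum_(k < n) u k x) ->
    (forall k, (dirichlet (u k) <= ((4 ^+ k)^-1)%:E)%E) ->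
  (dirichlet g < +oo)%E.
Proof.
move=> gE ule; apply: (@le_lt_trans _ _ 4%:E); last exact: ltry.
apply: ge_ereal_sup => _ [X [finX _] <-].
rewrite fsbig_finite // sumEFin lee_fin.
(* Large enough for the expansion of [g] at both ends of every pair in [X]. *)
pose n := (\max_(p <- fset_set X) maxn (N p.1) (N p.2))%N.
apply: le_trans (sum_geometric_le4 n).
have le_edge (p : G * G) : p \in fset_set X ->
    edge_energy g p <= \sum_(k < n) 2 ^+ k.+1 * edge_energy (u k) p.
  move=> pX; apply: le_trans (edge_energy_sum_le _ _ _).
  have /[!geq_max]/andP[N1 N2] : (maxn (N p.1) (N p.2) <= n)%N.
    by rewrite /n (big_rem p) //= leq_maxl.
  by rewrite /edge_energy (gE _ _ N1) (gE _ _ N2).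
rewrite big_seq (le_trans (ler_sum _ le_edge)) // -big_seq exchange_big /=.
apply: ler_sum => k _; rewrite -mulr_sumr ler_wpM2l ?exprn_ge0 //.
rewrite -lee_fin (le_trans _ (ule k)) // -sumEFin -fsbig_finite //.
by apply: esum_ge; exists X.
Qed.

Lemma half_lty (e : \bar R) : ((2^-1)%:E * e < +oo)%E <-> (e < +oo)%E.
Proof.
have h0 : 0 < 2^-1 :> R by rewrite invr_gt0.
by case: e => [r| |]; rewrite -?EFinM ?ltry // ?gt0_muley ?gt0_muleNy ?lte_fin.
Qed.

Lemma finite_energy_real u :
  finite_energy (fun x => (u x)%:C) <-> (dirichlet u < +oo)%E.
Proof.
rewrite -half_lty /finite_energy /energy /=.
suff -> : dirichlet u = (\esum_(p in [set: G * G])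
    (weight G p.1 p.2 * Normc.normc ((u p.1)%:C - (u p.2)%:C) ^+ 2)%:E)%E by [].
apply: eq_esum => p _.
by rewrite -rmorphB normcR real_normK ?num_real.
Qed.

(** By the reverse triangle inequality the modulus varies no more than [f] along each edge. *)
Lemma finite_energy_normc (f : G -> R[i]) :
  finite_energy f -> (dirichlet (fun x => Normc.normc (f x)) < +oo)%E.
Proof.
move=> /half_lty; apply: le_lt_trans; apply: le_esum => p _.
rewrite lee_fin ler_wpM2l ?weight_ge0 // -real_normK ?num_real //.
by rewrite lerXn2r ?nnegrE ?(le_trans _ (ler_dist_normc _ _)) ?ler_dist_normc.
Qed.

End Dirichlet.

Section Ramps.
Context {R : realType}.
Variables a c : nat -> R.
Hypothesis a_ge : forall k, k%:R <= a k.
Hypothesis c_ge0 : forall k, 0 <= c k.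

Definition ramp k (t : R) : R := c k * Num.max (t - a k) 0.

(** The full series over [k]: since [k <= a k], the ramps with index above [truncn t] vanish at
    [t]. *)
Definition ramp_sum (t : R) : R := \sum_(k < (Num.truncn t).+1) ramp k t.

Lemma ramp_eq0 k t : t <= a k -> ramp k t = 0.
Proof. by move=> ta; rewrite /ramp max_r ?mulr0 // subr_le0. Qed.

Lemma ramp_ge0 k t : 0 <= ramp k t.
Proof. by rewrite mulr_ge0 // le_max lexx orbT. Qed.

Lemma ramp_homo k : {homo ramp k : s t / s <= t}.
Proof. by move=> s t st; rewrite ler_wpM2l // le_max2 // lerD2r. Qed.

Lemma ramp_sumE t n :
  (Num.truncn t < n)%N -> ramp_sum t = \sum_(k < n) ramp k t.
Proof.
move=> tn; rewrite /ramp_sum -!(big_mkord xpredT (ramp^~ t)).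
rewrite [RHS](@big_cat_nat _ _ _ (Num.truncn t).+1) //=.
rewrite [X in _ + X]big_nat_cond [X in _ + X]big1 ?addr0 // => k /andP[/andP[tk _] _].
apply/ramp_eq0/(le_trans _ (a_ge k))/ltW/(lt_le_trans (truncnS_gt t)).
by rewrite ler_nat.
Qed.

Lemma ramp_sum_ge0 t : 0 <= ramp_sum t.
Proof. by apply: sumr_ge0 => k _; exact: ramp_ge0. Qed.

Lemma ramp_sum_incr k s t :
  s <= t -> ramp k t - ramp k s <= ramp_sum t - ramp_sum s.
Proof.
(* A common truncation for both points that includes the index [k]; the other increments are
   nonnegative. *)
move=> st; pose n := maxn k (maxn (Num.truncn s) (Num.truncn t)).
have [kn sn tn] : [/\ k < n.+1, Num.truncn s < n.+1 & Num.truncn t < n.+1]%N.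
  by rewrite !ltnS !leq_max !leqnn !orbT.
rewrite (ramp_sumE sn) (ramp_sumE tn) -sumrB (bigD1 (Ordinal kn)) //= lerDl.
by apply: sumr_ge0 => j _; rewrite subr_ge0 ramp_homo.
Qed.

Lemma mul_ramp_sum_incr k s t : 0 <= s -> 0 <= t ->
  `|a k * ramp k s - a k * ramp k t| <= `|s * ramp_sum s - t * ramp_sum t|.
Proof.
wlog st : s t / t <= s => [wl s0 t0|s0 t0].
  have [/wl->//|/ltW st] := leP t s.
  by rewrite distrC [leRHS]distrC wl.
have d0 : 0 <= ramp k s - ramp k t by rewrite subr_ge0 ramp_homo.
rewrite -mulrBr (le_trans _ (ler_norm _)) // ger0_norm; last first.
  by rewrite mulr_ge0 // (le_trans _ (a_ge k)).
have -> : s * ramp_sum s - t * ramp_sum t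
    = s * (ramp_sum s - ramp_sum t) + (s - t) * ramp_sum t by ring.
rewrite -[leLHS]addr0 lerD ?mulr_ge0 ?subr_ge0 ?ramp_sum_ge0 //.
apply: (@le_trans _ _ (s * (ramp k s - ramp k t))).
  (* Below the level [a k] both ramps vanish; above it the factor [s] dominates [a k]. *)
  have [sa|/ltW as_] := leP s (a k); last by rewrite ler_wpM2r.
  by rewrite !ramp_eq0 ?subrr ?mulr0 // (le_trans st).
by rewrite ler_wpM2l // ramp_sum_incr.
Qed.

End Ramps.

Theorem theorem2 (R : realType) (G : graph R) :
  connected_graph G ->
  finite_energy_is_algebra G ->
  canonically_compactifiable G.
Proof.
move=> Gc Galg f /finite_energy_normc; set F : G -> R := fun x => Normc.normc (f x) => Fe.
apply: contrapT => Funb.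
have {}Funb (M : R) : exists x, M < F x.
  apply: contrapT => Mub; apply: Funb; exists M => x.
  by rewrite leNgt; apply/negP => Mx; apply: Mub; exists x.
have [x0] := node_nonempty G.
have F0 x : 0 <= F x by rewrite /F; case: (f x) => u v /=; exact: sqrtr_ge0.
(* The summand [F x0] makes the truncation [h k] vanish at [x0]. As [F] is unbounded, [h k] is not
   constant and its energy is positive. *)
pose a k : R := 4 ^+ k + F x0.
have le4 k : k%:R <= 4 ^+ k :> R by rewrite -natrX ler_nat ltnW // ltn_expl.
have a_ge k : k%:R <= a k by rewrite (le_trans (le4 k)) // lerDl.
pose h k x : R := Num.max (F x - a k) 0.
have he k : (dirichlet (h k) < +oo)%E.
  apply: le_lt_trans Fe; apply: le_dirichlet => x y; rewrite /h.
  by apply: le_trans (ler_dist_max0 _ _) _; rewrite opprB addrA subrK.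
have h_gt0 k : (0 < dirichlet (h k))%E.
  rewrite lt_neqAle dirichlet_ge0 andbT eq_sym; apply/eqP => /(dirichlet_eq0_const Gc).
  have [y ay] := Funb (a k) => /(_ x0 y); rewrite /h.
  have ax0 : F x0 <= a k by rewrite lerDr exprn_ge0.
  rewrite max_r ?subr_le0 // max_l ?subr_ge0 ?ltW // => /esym/eqP.
  by rewrite subr_eq0 gt_eqF.
pose e k := fine (dirichlet (h k)).
have eE k : dirichlet (h k) = (e k)%:E.
  by rewrite fineK // ge0_fin_numE ?dirichlet_ge0.
have e0 k : 0 < e k by rewrite -lte_fin -eE.
(* Normalises the [k]-th ramp: [c k ^+ 2 * e k] is [4^-k]. *)
pose c k : R := (2 ^+ k * Num.sqrt (e k))^-1.
have c0 k : 0 <= c k by rewrite invr_ge0 mulr_ge0 ?exprn_ge0 ?sqrtr_ge0.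
have ue k : dirichlet (fun x => ramp a c k (F x)) = ((4 ^+ k)^-1)%:E.
  rewrite dirichletZ eE -EFinM; congr EFin.
  rewrite /c exprVn exprMn sqr_sqrtr ?ltW // -exprM mulnC exprM.
  by rewrite -[2 ^+ 2]natrX invfM mulfVK ?gt_eqF.
have g_lty : (dirichlet (fun x => ramp_sum a c (F x)) < +oo)%E.
  apply: (@dirichlet_sum_lty _ _ (fun k x => ramp a c k (F x))
    (fun x => (Num.truncn (F x)).+1)) => [x n|k]; last by rewrite ue.
  by move=> xn; apply: ramp_sumE.
pose Fg x : R := F x * ramp_sum a c (F x).
have Fg_lty : (dirichlet Fg < +oo)%E.
  apply/finite_energy_real.
  under eq_fun do rewrite rmorphM /=.
  (* The algebra hypothesis, applied to the complex embeddings of [F] and of the ramp sum. *)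
  by apply: Galg; apply/finite_energy_real.
have Fg_ge k : (k%:R%:E <= dirichlet Fg)%E.
  have : (dirichlet (fun x => a k * ramp a c k (F x))%R <= dirichlet Fg)%E.
    by apply: le_dirichlet => x y; exact: mul_ramp_sum_incr.
  (* From [a k >= 4^k] follows [a k ^+ 2 * 4^-k >= 4^k >= k]. *)
  apply: le_trans; rewrite dirichletZ ue -EFinM lee_fin (le_trans (le4 k)) //.
  rewrite ler_pdivlMr ?exprn_gt0 // -expr2 lerXn2r ?nnegrE ?exprn_ge0 ?lerDl //.
  by rewrite (le_trans _ (a_ge k)).
(* A finite energy lies strictly below its integer part plus one. *)
have := Fg_ge (Num.truncn (fine (dirichlet Fg))).+1.
rewrite -[leRHS]fineK ?ge0_fin_numE ?dirichlet_ge0 // lee_fin leNgt.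
by rewrite truncnS_gt.
Qed.
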